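(* Let $G$ be a totally disconnected, locally compact group and let $\alpha: G\to G$ be an endomorphism. Let $U$ be a compact, open subgroup of $G$. Then $U$ is minimizing for $\alpha$ if and only if the following three conditions all hold: (TA) $U = U_+U_-$; (TB1) $U_{++} = \bigcup_{n\geq 0}\alpha^n(U_+)$ is closed in $G$; and (TB2) the sequence of integers $\{[\alpha^{n+1}(U_+):\alpha^n(U_+)]\}_{n\in\mathbb{N}}$ is constant. (That is, $U$ is minimizing for $\alpha$ if and only if it is tidy for $\alpha$.)
   Context: An endomorphism of $G$ is a continuous homomorphism $\alpha:G\to G$; $\mathbb{N}=\{0,1,2,\dots\}$. For a compact open subgroup $U\leq G$ the index $[\alpha(U):\alpha(U)\cap U]$ is finite. The scale of $\alpha$ is $s(\alpha)=\min\{[\alpha(U):\alpha(U)\cap U] \mid U\leq G \text{ compact and open}\}$, and a compact open subgroup $U$ is minimizing for $\alpha$ if $[\alpha(U):\alpha(U)\cap U]=s(\alpha)$. For a compact open subgroup $U$ put $U_+ = \{x\in U \mid \exists \{x_n\}_{n\in\mathbb{N}}\subset U \text{ with } x_0=x \text{ and } \alpha(x_{n+1})=x_n \text{ for every } n\}$ and $U_- = \{x\in U\mid \alpha^n(x)\in U \text{ for every } n\in\mathbb{N}\}$. These are closed subgroups of $U$, and $\alpha(U_+)\geq U_+$. A compact open subgroup is tidy for $\alpha$ if it satisfies (TA), (TB1) and (TB2). *)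

(* Defs.v *)
From HB Require Import structures.
From mathcomp Require Import all_boot all_order finmap.
From mathcomp Require Import all_classical topology.

Set Implicit Arguments.
Unset Strict Implicit.
Unset Printing Implicit Defensive.

Local Open Scope classical_set_scope.
Local Open Scope group_scope.

HB.structure Definition PreTopologicalGroup :=
  {G of Topological G & Group G}.

HB.mixin Record PreTopologicalGroup_isTopologicalGroup G
    of PreTopologicalGroup G := {
  mulg_continuous : continuous (fun p : G * G => p.1 * p.2) ;
  invg_continuous : continuous (fun x : G => x^-1)
}.

#[short(type="topologicalGroupType")]
HB.structure Definition TopologicalGroup :=
  {G of PreTopologicalGroup G & PreTopologicalGroup_isTopologicalGroup G}.

Definition subgroup (G : groupType) (U : set G) : Prop :=
  group_closed [in U].

Definition compact_open_subgroup (G : topologicalGroupType) (U : set G) : Prop :=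
  [/\ subgroup U, compact U & open U].

(* [A : B], the number of left cosets of B in A. It has the junk value 0 when
   there are infinitely many of them; for a continuous endomorphism and a
   compact open U all indices taken below are finite, by compactness. *)
Definition subgroup_index (G : groupType) (A B : set G) : nat :=
  #|` fset_set [set [set x * b | b in B] | x in A] |.

Section Endomorphism.
Variables (G : topologicalGroupType) (alpha : G -> G).
Implicit Type U : set G.

Definition displacement_index U : nat :=
  subgroup_index (alpha @` U) (alpha @` U `&` U).

Definition is_min (S : set nat) (m : nat) : Prop :=
  S m /\ forall n, S n -> (m <= n)%N.

(* The default value 0 is used only if G has no compact open subgroup. *)
Definition scale : nat :=
  xget 0%N (is_min [set displacement_index U | U in @compact_open_subgroup G]).

Definition minimizing U : Prop :=
  compact_open_subgroup U /\ displacement_index U = scale.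

Definition plus_part U : set G :=
  [set x | U x /\ exists u : nat -> G,
    [/\ forall n, U (u n), u 0%N = x & forall n, alpha (u n.+1) = u n]].

Definition minus_part U : set G :=
  [set x | U x /\ forall n, U (iter n alpha x)].

Definition iter_image n U : set G := iter n alpha @` U.

Definition plusplus_part U : set G :=
  \bigcup_n iter_image n (plus_part U).

Definition TA U : Prop :=
  U = [set x * y | x in plus_part U & y in minus_part U].

Definition TB1 U : Prop := closed (plusplus_part U).

Definition TB2 U : Prop :=
  exists c : nat, forall n,
    subgroup_index (iter_image n.+1 (plus_part U))
                   (iter_image n (plus_part U)) = c.

End Endomorphism.

(* Main.v *)
Require Import Defs.
From HB Require Import structures.
From mathcomp Require Import all_boot all_order finmap.
From mathcomp Require Import all_classical topology.
From mathcomp Require Import zify.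

(** Write [d_n V] for the index of [alpha^n V /\ V] in [alpha^n V]. Always
    [d_n V <= (d_1 V)^n], and [d_n U <= C * d_n V] for a constant [C] depending
    only on [U] and [V]; hence [V] is minimizing as soon as
    [(d_1 V)^n <= C * d_n V] for all [n].

    If [U] is tidy, Baire's theorem and (TB2) give [alpha^n U_+ /\ U = U_+],
    whence [d_n U = (d_1 U)^n].

    Conversely, in a class of compact open subgroups stable under
    [W |-> W /\ alpha^-1 W] those with minimal [d_1] satisfy (TA): the indices
    of [W] and [W /\ alpha^-1 W] agree, so
    [W = (alpha W /\ W)(W /\ alpha^-1 W)], and one iterates and uses
    compactness. Applied to the class of subgroups of [U] normalized by the
    group [L] of points homoclinic to [U], this yields [N] such that
    [V = N * L_N], with [L_N] the group of points homoclinic to [N], satisfies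
    [d_n V = (d_1 V)^n]. So if [U] is minimizing then [(d_1 U)^n <= C * d_n U],
    while by (TA) the product of [d_n U] and [[alpha^n U_+ /\ U : U_+]] is
    [\prod_(k < n) [alpha^(k+1) U_+ : alpha^k U_+]], with nonincreasing factors
    starting at [d_1 U]. Hence all factors are equal, which is (TB2), and
    [[alpha^n U_+ /\ U : U_+]] is bounded, which implies (TB1). *)

Set Implicit Arguments.
Unset Strict Implicit.
Unset Printing Implicit Defensive.

Local Open Scope classical_set_scope.
Local Open Scope group_scope.

Section Subgroups.
Variable G : groupType.
Implicit Types (A B C : set G) (x y : G).

Lemma subgroupP A :
  subgroup A <-> A 1 /\ forall x y, A x -> A y -> A (x^-1 * y).
Proof.
split=> [[A1 AF]|[A1 AF]].
  have AV x : A x -> A x^-1.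
    by move=> Ax; have := AF 1 x A1; rewrite !inE mul1g; apply.
  rewrite inE in A1; split=> // x y /AV Ax Ay.
  by have := AF x^-1 y^-1; rewrite !inE invgK; apply => //; exact: AV.
have AV x : A x -> A x^-1 by move=> Ax; have := AF x 1 Ax A1; rewrite mulg1.
split; first by rewrite inE.
move=> x y; rewrite !inE => Ax Ay.
by have := AF x^-1 y^-1 (AV _ Ax) (AV _ Ay); rewrite invgK.
Qed.

Lemma subgroup1 A : subgroup A -> A 1.
Proof. by case/subgroupP. Qed.

Lemma subgroupVM A x y : subgroup A -> A x -> A y -> A (x^-1 * y).
Proof. by case/subgroupP=> _; apply. Qed.

Lemma subgroupV A x : subgroup A -> A x -> A x^-1.
Proof.
by move=> sA Ax; have := subgroupVM sA Ax (subgroup1 sA); rewrite mulg1.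
Qed.

Lemma subgroupM A x y : subgroup A -> A x -> A y -> A (x * y).
Proof.
by move=> sA Ax Ay; rewrite -[x]invgK; apply: subgroupVM => //;
  exact: subgroupV.
Qed.

Lemma subgroupI A B : subgroup A -> subgroup B -> subgroup (A `&` B).
Proof.
move=> sA sB; apply/subgroupP; split; first by split; exact: subgroup1.
by move=> x y [Ax Bx] [Ay By]; split; exact: subgroupVM.
Qed.

Lemma subgroup_image A (f : UMagmaMorphism.type G G) :
  subgroup A -> subgroup (f @` A).
Proof.
move=> sA; apply/subgroupP; split.
  by exists 1; [exact: subgroup1 | exact: gmulf1].
move=> _ _ [x Ax <-] [y Ay <-]; exists (x^-1 * y); first exact: subgroupVM.
by rewrite gmulfM gmulfV.
Qed.

Lemma subgroup_preimage A (f : UMagmaMorphism.type G G) :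
  subgroup A -> subgroup (f @^-1` A).
Proof.
move=> sA; apply/subgroupP; split; first by rewrite /= gmulf1; exact: subgroup1.
by move=> x y /= Ax Ay; rewrite gmulfM gmulfV; exact: subgroupVM.
Qed.

End Subgroups.

Ltac solve_subgroup :=
  by repeat (first [done | apply: subgroupI | apply: subgroup_image]).

(** * Finite indices and comparison of coset spaces *)

Section Index.
Variable G : groupType.
Implicit Types (A B C : set G) (x y : G).

Definition finite_index A B :=
  finite_set [set [set x * b | b in B] | x in A].

Definition transversal A B (T : finType) (t : T -> G) :=
  [/\ forall i, A (t i), forall x, A x -> exists i, B ((t i)^-1 * x)
    & forall i j, B ((t i)^-1 * t j) -> i = j].

Lemma coset_eqP B x y : subgroup B ->
  [set x * b | b in B] = [set y * b | b in B] <-> B (x^-1 * y).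
Proof.
move=> sB; split=> [E|Bxy].
  have : [set y * b | b in B] y by exists 1; [exact: subgroup1 | rewrite mulg1].
  by rewrite -E => -[b Bb <-]; rewrite mulKg.
apply/seteqP; split=> _ [b Bb <-].
  exists ((x^-1 * y)^-1 * b); first exact: subgroupVM.
  by rewrite ?gnorm.
exists (x^-1 * y * b); first exact: subgroupM.
by rewrite ?gnorm.
Qed.

Lemma transversal_exists A B : subgroup B -> finite_index A B ->
  exists (T : finType) (t : T -> G),
    transversal A B t /\ #|T| = subgroup_index A B.
Proof.
move=> sB fAB; set S := fset_set [set [set x * b | b in B] | x in A].
have SP (c : S) : exists x, A x /\ [set x * b | b in B] = val c.
  have : val c \in S by exact: valP.
  by rewrite in_fset_set // inE => -[x Ax <-]; exists x.
have [t tP] := choice SP.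
exists S, t; split; last by rewrite /subgroup_index -/S cardfE.
split=> [i|x Ax|i j /coset_eqP]; first by have [] := tP i.
  have xS : [set x * b | b in B] \in S.
    by rewrite in_fset_set // inE; exists x.
  exists [` xS]%fset; apply/coset_eqP => //.
  by have [_ ->] := tP [` xS]%fset.
move=> /(_ sB) E; apply: val_inj.
by have [_ <-] := tP i; have [_ <-] := tP j.
Qed.

Lemma finite_index_cover A B (T : finType) (t : T -> G) : subgroup B ->
  (forall x, A x -> exists i, B ((t i)^-1 * x)) -> finite_index A B.
Proof.
move=> sB cov.
apply: (@sub_finite_set _ _ [set [set t i * b | b in B] | i in [set: T]]).
  move=> _ [x Ax <-]; have [i Bi] := cov x Ax.
  by exists i => //; exact/coset_eqP.
by apply: finite_image; exact: finite_finset.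
Qed.

Lemma index_transversal A B (T : finType) (t : T -> G) : subgroup B ->
  transversal A B t -> subgroup_index A B = #|T|.
Proof.
move=> sB [tA cov inj]; have fAB := finite_index_cover sB cov.
have E : [set [set x * b | b in B] | x in A]
       = [set` [fset [set t i * b | b in B] | i in T]%fset].
  apply/seteqP; split=> [_ [x Ax <-]|c /= /imfsetP[i _ ->]]; last first.
    by exists (t i).
  have [i Bi] := cov x Ax; apply/imfsetP; exists i => //.
  by apply/esym/coset_eqP.
rewrite /subgroup_index E set_fsetK card_imfset ?cardE //=.
by move=> i j /coset_eqP E'; apply: inj; exact: E'.
Qed.

(** [R] stands for a map from [A/B] to [A'/B'] without a choice of images; the last two hypotheses
    make it total and injective on cosets. The rest is counting: an injection between finite sets of
    equal size is onto, which gives the final clause. *)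
Lemma index_map (R : G -> G -> Prop) A B A' B' :
  subgroup B -> subgroup B' -> finite_index A' B' ->
  (forall x, A x -> exists2 x', A' x' & R x x') ->
  (forall x y x' y', A x -> A y -> A' x' -> A' y' -> R x x' -> R y y' ->
     B' (x'^-1 * y') -> B (x^-1 * y)) ->
  [/\ finite_index A B, (subgroup_index A B <= subgroup_index A' B')%N
    & (subgroup_index A' B' <= subgroup_index A B)%N ->
      forall x', A' x' -> exists x x'', [/\ A x, A' x'', R x x''
                                         & B' (x''^-1 * x')]].
Proof.
move=> sB sB' fin' tot inj.
have [T' [t' [[tA' cov' inj'] cT']]] := transversal_exists sB' fin'.
have fin : finite_index A B.
  (* One element of [A] is chosen above each class of [A'/B'] that [R] reaches, and the default [1]
     for the other classes; by injectivity the choices meet every coset of [B] in [A]. *)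
  pose P i x := exists2 x', A x /\ A' x' & R x x' /\ B' ((t' i)^-1 * x').
  have PP i : exists x, (exists z, P i z) -> P i x.
    have [[z Pz]|nP] := pselect (exists z, P i z); first by exists z.
    by exists 1 => /nP.
  have [s sP] := choice PP.
  apply: (@finite_index_cover _ _ _ s) => // x Ax.
  have [x' Ax' Rx] := tot x Ax; have [i Bi] := cov' x' Ax'.
  have [|y' [Ay Ay'] [Ry By]] := sP i; first by exists x, x'.
  exists i; apply: (inj (s i) x y' x') => //.
  rewrite (_ : _ * _ = ((t' i)^-1 * y')^-1 * ((t' i)^-1 * x')).
    exact: subgroupVM.
  by rewrite ?gnorm.
have [T [t [[tA cov injt] cT]]] := transversal_exists sB fin.
have fP i : exists k : G * T',
    [/\ A' k.1, R (t i) k.1 & B' ((t' k.2)^-1 * k.1)].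
  have [x' Ax' Rx] := tot (t i) (tA i); have [j Bj] := cov' x' Ax'.
  by exists (x', j).
have [f {}fP] := choice fP.
have finj : injective (fun i => (f i).2).
  move=> i j E; apply: injt; have [Ai Ri Bi] := fP i; have [Aj Rj Bj] := fP j.
  apply: (inj _ _ (f i).1 (f j).1) => //.
  rewrite (_ : _ * _ = ((t' (f i).2)^-1 * (f i).1)^-1 * ((t' (f j).2)^-1 * (f
    j).1)).
    exact: subgroupVM.
  by rewrite E; rewrite ?gnorm.
split=> //; first by rewrite -cT -cT'; exact: leq_card finj.
rewrite -cT -cT' => le x' Ax'.
have [j Bj] := cov' x' Ax'.
have /codomP[i Ej] := inj_card_onto finj le j.
have [Ai Ri Bi] := fP i; exists (t i), (f i).1; split=> //.
rewrite (_ : _ * _ = ((t' (f i).2)^-1 * (f i).1)^-1 * ((t' j)^-1 * x')).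
  exact: subgroupVM.
by rewrite Ej; rewrite ?gnorm.
Qed.

Lemma index_mul A B C : subgroup A -> subgroup B -> subgroup C ->
  C `<=` B -> B `<=` A -> finite_index A B -> finite_index B C ->
  finite_index A C /\
  subgroup_index A C = (subgroup_index A B * subgroup_index B C)%N.
Proof.
move=> sA sB sC CB BA fAB fBC.
have [T [t [[tA cov inj] <-]]] := transversal_exists sB fAB.
have [S [s [[sS cov' inj'] <-]]] := transversal_exists sC fBC.
have tr : transversal A C (fun k : T * S => t k.1 * s k.2).
  split=> [[i j]|x Ax|[i j] [k l]] /=.
  - by apply: subgroupM => //; exact: BA.
  - have [i Bi] := cov x Ax; have [j Bj] := cov' _ Bi.
    by exists (i, j); rewrite /= invgM -mulgA.
  move=> E; have E1 : i = k.
    apply: inj; rewrite (_ :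
      _ * _ = s j * ((t i * s j)^-1 * (t k * s l)) * (s l)^-1).
      apply: subgroupM => //; last exact: subgroupV.
      by apply: subgroupM => //; exact: CB.
    by rewrite ?gnorm.
  rewrite E1; congr pair; apply: inj'; move: E; rewrite E1.
  by rewrite invgM -mulgA mulKg.
have [_ covAC _] := tr; split; first exact: finite_index_cover covAC.
by rewrite (index_transversal sC tr) card_prod.
Qed.

Lemma index_gt0 A B : subgroup A -> subgroup B -> finite_index A B ->
  (0 < subgroup_index A B)%N.
Proof.
move=> sA sB fAB; have [T [t [[_ cov _] <-]]] := transversal_exists sB fAB.
by have [i _] := cov 1 (subgroup1 sA); apply/card_gt0P; exists i.
Qed.

Lemma index_le1 A B : subgroup A -> subgroup B -> finite_index A B ->
  (subgroup_index A B <= 1)%N -> A `<=` B.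
Proof.
move=> sA sB fAB; have [T [t [[_ cov _] <-]]] := transversal_exists sB fAB.
move=> /card_le1P T1 x Ax; have [i Bi] := cov 1 (subgroup1 sA).
have [j Bj] := cov x Ax.
have E : j = i by apply/eqP; have := T1 i isT j; rewrite inE.
rewrite E in Bj; rewrite -[x]mulg1.
rewrite (_ : x * 1 = ((t i)^-1 * 1)^-1 * ((t i)^-1 * x));
  first exact: subgroupVM.
by rewrite ?gnorm.
Qed.

Lemma index_self A : subgroup A -> subgroup_index A A = 1%N.
Proof.
move=> sA; have := @index_transversal A A unit (fun=> 1) sA.
rewrite card_unit; apply; split=> [_|x Ax|[] []//]; first exact: subgroup1.
by exists tt; rewrite invg1 mul1g.
Qed.

(** Elements of [A] in one coset of [B'] differ by an element of [A /\ B'], so the inclusion of [A]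
    in [A'] is injective on cosets. *)
Lemma index_sub A B A' B' : subgroup B -> subgroup B' -> finite_index A' B' ->
  A `<=` A' -> A `&` B' `<=` B -> (forall x y, A x -> A y -> A (x^-1 * y)) ->
  finite_index A B /\ (subgroup_index A B <= subgroup_index A' B')%N.
Proof.
move=> sB sB' fin' AA' BB' AF.
have [//|x Ax|x y _ _ Ax Ay _ _ <- <- Bxy|? ? _] :=
    @index_map (fun x y => x = y) A B A' B' sB sB'.
- by exists x => //; exact: AA'.
- by apply: BB'; split=> //; exact: AF.
by [].
Qed.

Lemma index_image (f : UMagmaMorphism.type G G) A B : subgroup B ->
  finite_index A B -> finite_index (f @` A) (f @` B) /\
  (subgroup_index (f @` A) (f @` B) <= subgroup_index A B)%N.
Proof.
move=> sB fin.
have [//|_ [x Ax <-]|_ _ x y _ _ Ax Ay <- <- Bxy|? ? _] :=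
  @index_map (fun y x => f x = y) (f @` A) (f @` B) A B (subgroup_image f sB)
    sB.
- by exists x.
- by exists (x^-1 * y) => //; rewrite gmulfM gmulfV.
by [].
Qed.

End Index.

(** * Topological groups: translations, compactness, separation *)

Section Topology.
Variable G : topologicalGroupType.
Implicit Types (A B U : set G) (x y : G).

Lemma mulg_continuousl x : continuous (fun y : G => x * y).
Proof.
move=> y.
apply: (@continuous_comp _ _ _ (fun y => (x, y)) (fun p => p.1 * p.2)).
  by apply: cvg_pair; [exact: cvg_cst | exact: cvg_id].
exact: mulg_continuous.
Qed.

Lemma mulg_continuousr x : continuous (fun y : G => y * x).
Proof.
move=> y.
apply: (@continuous_comp _ _ _ (fun y => (y, x)) (fun p => p.1 * p.2)).
  by apply: cvg_pair; [exact: cvg_id | exact: cvg_cst].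
exact: mulg_continuous.
Qed.

Lemma open_translate U x : open U -> open [set y | U (x^-1 * y)].
Proof. by move=> oU; apply: open_comp => // y _; exact: mulg_continuousl. Qed.

Lemma nbhs_translate U x y : open U -> U (x^-1 * y) ->
  nbhs y [set z | U (x^-1 * z)].
Proof.
by move=> oU Uxy; apply: open_nbhs_nbhs; split=> //; exact: open_translate.
Qed.

Lemma open_subgroup_closed U : subgroup U -> open U -> closed U.
Proof.
move=> sU oU x clx.
have [|y [Uy /= Uxy]] := clx [set y | U (x^-1 * y)].
  by apply: nbhs_translate; rewrite // mulVg; exact: subgroup1.
rewrite -[x]invgK (_ : x^-1 = x^-1 * y * y^-1); last by rewrite mulgK.
by apply: subgroupV => //; apply: subgroupM => //; exact: subgroupV.
Qed.

(** Finitely many translates of [U] cover [A], and their centres represent all cosets. The condition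
    on [U] and [B] only concerns quotients of elements of [A], which allows a [B] that is not open,
    such as [A /\ U]. *)
Lemma finite_index_compact A B U : compact A -> open U -> U 1 -> subgroup B ->
  (forall x y, A x -> A y -> U (x^-1 * y) -> B (x^-1 * y)) -> finite_index A B.
Proof.
pose P : ptopologicalType := HB.pack (G : Type) (isPointed.Build G 1) G.
move=> cA oU U1 sB UB.
have := cA; rewrite (@compact_cover P).
move=> /(_ G A (fun x => [set y | U (x^-1 * y)])).
case=> [x _|x Ax|D DA cov]; first exact: open_translate.
  by exists x => //=; rewrite mulVg.
apply: (@finite_index_cover _ _ _ D val) => // x Ax.
have [y yD Uyx] := cov x Ax; exists [` yD]%fset; apply: UB => //.
by have := DA y yD; rewrite inE.
Qed.

(** Cantor's intersection theorem: a cluster point of the filter generated by the [E n] lies in each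
    of them. *)
Lemma nested_compact (E : nat -> set G) : (forall n, closed (E n)) ->
  compact (E 0%N) -> (forall n, E n !=set0) -> (forall n, E n.+1 `<=` E n) ->
  exists x, forall n, E n x.
Proof.
move=> clE cE E0 Edec.
have mono m n : (m <= n)%N -> E n `<=` E m.
  elim: n => [|n IH]; first by rewrite leqn0 => /eqP->.
  by rewrite leq_eqVlt => /predU1P[->//|/IH mn x /Edec/mn].
have FF : ProperFilter (filter_from [set: nat] E).
  apply: filter_from_proper => //; apply: filter_from_filter;
    first by exists 0%N.
  by move=> i j _ _; exists (maxn i j) => // x Ex; split; apply: mono Ex;
    rewrite leq_max leqnn ?orbT.
have [|x [_ cx]] := cE _ FF; first by exists 0%N.
exists x => n; apply: clE => B Bx; apply: cx => //; by exists n.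
Qed.

(** The singleton of [1] is closed, being a connected component, so by continuity [x^-1 * y] stays
    away from [1] near a pair of distinct points. *)
Lemma totally_disconnected_hausdorff :
  totally_disconnected [set: G] -> hausdorff_space G.
Proof.
move=> tdG; have cl1 : closed [set (1 : G)].
  by rewrite -(tdG 1 I); exact: component_closed.
move=> x y clxy; apply: contrapT => nxy.
have cF : {for (x, y), continuous (fun p : G * G => p.1^-1 * p.2)}.
  apply: (@continuous_comp _ _ _ (fun p : G * G => (p.1^-1, p.2))
                                 (fun p => p.1 * p.2)).
    apply: cvg_pair => /=; last exact: cvg_snd.
    by apply: cvg_comp; [exact: cvg_fst | exact: invg_continuous].
  exact: mulg_continuous.
have [|[A B] /= [nA nB] AB] := cF (~` [set 1]).
  apply: open_nbhs_nbhs; split; first exact: closed_openC.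
  by move=> /= /(canRL (mulKg _)); rewrite invgK mulg1 => /esym.
have [z [Az Bz]] := clxy _ _ nA nB.
by have /= := AB (z, z) (conj Az Bz); rewrite mulVg.
Qed.

End Topology.

(** * Displacement indices of the iterates of [alpha] *)

Section Endo.
Variables (G : topologicalGroupType) (alpha : UMagmaMorphism.type G G).
Hypothesis alpha_cont : continuous alpha.
Implicit Types (A B U V W : set G) (x y : G).

Lemma iter_monoid_morphism n : monoid_morphism (iter n alpha).
Proof.
split; first by elim: n => //= n ->; exact: gmulf1.
by elim: n => // n IH x y; rewrite !iterS IH gmulfM.
Qed.

HB.instance Definition _ n :=
  isUMagmaMorphism.Build G G (iter n alpha) (iter_monoid_morphism n).

Lemma iter_gmulfM n x y :
  iter n alpha (x * y) = iter n alpha x * iter n alpha y.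
Proof. exact: gmulfM. Qed.

Lemma iter_gmulfVM n x y :
  iter n alpha (x^-1 * y) = (iter n alpha x)^-1 * iter n alpha y.
Proof. by rewrite iter_gmulfM (gmulfV (iter n alpha)). Qed.

Lemma iter_continuous n : continuous (iter n alpha).
Proof.
elim: n => [|n IH] x; first exact: cvg_id.
by apply: (@continuous_comp _ _ _ (iter n alpha) alpha);
  [exact: IH | exact: alpha_cont].
Qed.

Lemma iter_imageS n A : iter_image alpha n.+1 A = alpha @` iter_image alpha n A.
Proof. by rewrite /iter_image image_comp. Qed.

Lemma iter_image_compact n A : compact A -> compact (iter_image alpha n A).
Proof.
by apply: continuous_compact; apply: continuous_subspaceT;
  exact: iter_continuous.
Qed.

Lemma subgroup_iter_image n A : subgroup A -> subgroup (iter_image alpha n A).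
Proof. exact: (subgroup_image (iter n alpha)). Qed.

Definition displacement n U :=
  subgroup_index (iter_image alpha n U) (iter_image alpha n U `&` U).

Lemma displacement1 U : displacement 1 U = displacement_index alpha U.
Proof. by []. Qed.

Lemma finite_displacement n A U : compact_open_subgroup U -> compact A ->
  subgroup A ->
  finite_index (iter_image alpha n A) (iter_image alpha n A `&` U).
Proof.
move=> [sU _ oU] cA sA; have sAn := subgroup_iter_image n sA.
apply: (@finite_index_compact _ _ _ U); rewrite //.
- exact: iter_image_compact.
- exact: subgroup1.
- exact: subgroupI.
by move=> x y Ax Ay Uxy; split=> //; exact: subgroupVM.
Qed.

Lemma displacement_gt0 n U :
  compact_open_subgroup U -> (0 < displacement n U)%N.
Proof.
move=> hU; have [sU cU _] := hU; have sUn := subgroup_iter_image n sU.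
apply: index_gt0 => //; first exact: subgroupI.
exact: finite_displacement.
Qed.

(** With [A := alpha^(n+1) V], the map [alpha] bounds [[A : A /\ alpha V]] by [d_n V], while
    [[A /\ alpha V : A /\ alpha V /\ V]] is at most [d_1 V]. *)
Lemma displacement_le_exp n V : compact_open_subgroup V ->
  (displacement n V <= displacement_index alpha V ^ n)%N.
Proof.
move=> hV; have [sV cV _] := hV.
elim: n => [|n IH].
  rewrite expn0 /displacement (_ : iter_image alpha 0 V = V);
    last exact: image_id.
  by rewrite setIid index_self.
have sI k := subgroup_iter_image k sV; pose A := iter_image alpha n.+1 V.
have s1 := subgroup_image alpha sV.
have fin k : finite_index (iter_image alpha k V) (iter_image alpha k V `&` V).
  exact: finite_displacement.
have [|||_ [x Vx <-]|_ _ x y _ _ Ax Ay <- <- [Bxy Vxy]|fAB leAB _] :=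
  @index_map _ (fun y x => alpha x = y) A (A `&` (alpha @` V))
   (iter_image alpha n V) (iter_image alpha n V `&` V).
- by apply: subgroupI; [exact: (sI n.+1) | exact: s1].
- by apply: subgroupI.
- exact: fin.
- by exists (iter n alpha x) => //; exists x.
- rewrite -gmulfV -gmulfM; split; last by exists (x^-1 * y).
  by rewrite /A iter_imageS; exists (x^-1 * y) => //; exact: subgroupVM.
have [|||||x y [Ax Vx] [Ay Vy]|fBC leBC] :=
  @index_sub _ (A `&` (alpha @` V)) (A `&` (alpha @` V) `&` V) (alpha @` V)
  (alpha @` V `&` V).
- by apply: subgroupI => //; apply: subgroupI => //; exact: sI.
- exact: subgroupI.
- exact: (fin 1%N).
- by move=> x [].
- by move=> x [] [] ? ? [].
- by split; [exact: (subgroupVM (sI n.+1)) | exact: subgroupVM].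
have sAB : subgroup (A `&` (alpha @` V)) by apply: subgroupI => //; exact: sI.
have [|||||fAC EAC] :=
  @index_mul _ A (A `&` (alpha @` V)) (A `&` (alpha @` V) `&` V) (sI n.+1) sAB;
  rewrite //; try solve_subgroup.
have [||||||_ le] := @index_sub _ A (A `&` V) A (A `&` (alpha @` V) `&` V);
  rewrite //; try solve_subgroup.
- by move=> x [? [[]]].
- by move=> x y; exact: (subgroupVM (sI n.+1)).
apply: (leq_trans le); rewrite EAC expnSr; apply: leq_mul => //.
exact: leq_trans IH.
Qed.

(** With [W := U /\ V], the index [[alpha^n U : alpha^n W /\ W]] is the product of
    [[alpha^n U : alpha^n W] <= [U : W]], [[alpha^n W : alpha^n W /\ V] <= d_n V] and
    [[alpha^n W /\ V : alpha^n W /\ W] <= [V : W]]. *)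
Lemma displacement_comparable U V :
  compact_open_subgroup U -> compact_open_subgroup V ->
  exists C, forall n, (displacement n U <= C * displacement n V)%N.
Proof.
move=> hU hV; have [sU cU oU] := hU; have [sV cV oV] := hV.
pose W := U `&` V; have sW : subgroup W by exact: subgroupI.
have hW : compact_open_subgroup W.
  split=> //; last exact: openI.
  by apply: compact_closedI => //; exact: open_subgroup_closed.
have fin A : compact A -> subgroup A -> W `<=` A -> finite_index A W.
  move=> cA sA WA; apply: (@finite_index_compact _ _ _ W) => //.
    by case: hW.
  exact: subgroup1.
have fUW : finite_index U W by apply: fin => // x [].
have fVW : finite_index V W by apply: fin => // x [].
exists (subgroup_index U W * subgroup_index V W)%N => n.
pose a A := iter_image alpha n A; have sa A := @subgroup_iter_image n A.
have aS A B : A `<=` B -> a A `<=` a B by exact: image_subset.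
have WU : W `<=` U by move=> x [].
have WV : W `<=` V by move=> x [].
have [f1 l1] := index_image (iter n alpha) sW fUW.
have [|||||x y [Ax Vx] [Ay Vy]|f2 l2] :=
  @index_sub _ (a W `&` V) (a W `&` W) V W; rewrite //; try solve_subgroup.
- by move=> x [[]].
- by split; [exact: (subgroupVM (sa W sW)) | exact: subgroupVM].
have [||||||f3 l3] := @index_sub _ (a W) (a W `&` V) (a V) (a V `&` V);
  try solve_subgroup.
- exact: finite_displacement.
- exact: aS.
- by move=> x [? []].
- by move=> x y; exact: (subgroupVM (sa W sW)).
have [|||||||f4 E4] := @index_mul _ (a W) (a W `&` V) (a W `&` W); rewrite //;
  try solve_subgroup.
- by move=> x [? []].
have [|||||||f5 E5] := @index_mul _ (a U) (a W) (a W `&` W); rewrite //;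
  try solve_subgroup.
- exact: aS.
have [||||||_ l6] := @index_sub _ (a U) (a U `&` U) (a U) (a W `&` W);
  rewrite //; try solve_subgroup.
- by move=> x [? [? /WU]].
- by move=> x y; exact: (subgroupVM (sa U sU)).
apply: (leq_trans l6); rewrite E5 E4 -mulnA; apply: leq_mul => //.
by rewrite mulnC; exact: leq_mul.
Qed.

End Endo.

Lemma exp_le_mul_exp a b C : (forall n, a ^ n <= C * b ^ n)%N -> (a <= b)%N.
Proof.
move=> H; rewrite leqNgt; apply/negP => ba.
(* Bernoulli's inequality, using [b + 1 <= a]. *)
have B n : (b ^ n.+1 + n.+1 * b ^ n <= a ^ n.+1)%N.
  elim: n => [|n IH]; first by rewrite !expn1 expn0; lia.
  have : (b.+1 * (b ^ n.+1 + n.+1 * b ^ n) <= a * a ^ n.+1)%N by exact: leq_mul.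
  rewrite !expnS; nia.
have [b0|b0] := posnP b.
  have := H 1%N; rewrite b0 !expn1 muln0; lia.
(* At exponent [C * b + 1] the term [(C * b + 1) * b ^ (C * b)] alone exceeds
   [C * b ^ (C * b + 1)]. *)
have := leq_trans (B (C * b)%N) (H (C * b).+1); rewrite !expnS.
have : (0 < b ^ (C * b))%N by rewrite expn_gt0 b0.
nia.
Qed.

(** * The groups [U_+] and [U_-], homoclinic points, and (TA) from minimality *)

Section Parts.
Variables (G : topologicalGroupType) (alpha : UMagmaMorphism.type G G).
Implicit Types (A B U V W : set G) (x y : G).
Local Notation plus := (plus_part alpha).
Local Notation minus := (minus_part alpha).
Local Notation image n := (iter_image alpha n).

Lemma plus_part_sub U : plus U `<=` U.
Proof. by move=> x []. Qed.

Lemma minus_part_sub U : minus U `<=` U.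
Proof. by move=> x []. Qed.

Lemma plus_partS U V : U `<=` V -> plus U `<=` plus V.
Proof.
by move=> UV x [/UV Ux [u [Uu u0 uS]]]; split=> //; exists u; split=> // n;
  exact/UV.
Qed.

Lemma minus_partS U V : U `<=` V -> minus U `<=` minus V.
Proof. by move=> UV x [/UV Ux Un]; split=> // n; exact/UV. Qed.

Lemma plus_part_lift U x : plus U x -> exists2 y, plus U y & alpha y = x.
Proof.
move=> [Ux [u [Uu u0 uS]]]; exists (u 1%N); last by rewrite uS.
by split=> //; exists (fun n => u n.+1).
Qed.

Lemma plus_part_image U x : plus U x -> U (alpha x) -> plus U (alpha x).
Proof.
move=> [Ux [u [Uu u0 uS]]] Uax; split=> //.
exists (fun n => if n is m.+1 then u m else alpha x).
by split=> [[|n]||[|n]] //; rewrite u0.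
Qed.

Lemma minus_part_iter U n x : minus U x -> minus U (iter n alpha x).
Proof. by move=> [Ux Un]; split=> // k; rewrite -iterD. Qed.

Lemma subgroup_plus_part U : subgroup U -> subgroup (plus U).
Proof.
move=> sU; apply/subgroupP; split.
  split; first exact: subgroup1.
  by exists (fun=> 1); split=> // n; [exact: subgroup1 | exact: gmulf1].
move=> x y [Ux [u [Uu u0 uS]]] [Uy [v [Uv v0 vS]]]; split;
  first exact: subgroupVM.
exists (fun n => (u n)^-1 * v n); split=> [n||n]; first exact: subgroupVM.
  by rewrite u0 v0.
by rewrite gmulfM gmulfV uS vS.
Qed.

Lemma subgroup_minus_part U : subgroup U -> subgroup (minus U).
Proof.
move=> sU; apply/subgroupP; split.
  by split=> [|n]; [|rewrite gmulf1]; exact: subgroup1.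
move=> x y [Ux Un] [Uy Vn]; split=> [|n]; first exact: subgroupVM.
by rewrite iter_gmulfVM; exact: subgroupVM.
Qed.

Lemma image_plus_partS n U : image n (plus U) `<=` image n.+1 (plus U).
Proof.
move=> _ [x /plus_part_lift[y Uy <-] <-]; exists y => //.
by rewrite iterSr.
Qed.

Lemma image_plus_part_le m n U :
  (m <= n)%N -> image m (plus U) `<=` image n (plus U).
Proof.
elim: n => [|n IH]; first by rewrite leqn0 => /eqP->.
rewrite leq_eqVlt => /predU1P[->//|/IH mn x /mn].
exact: image_plus_partS.
Qed.

Lemma plusplus_partS U V :
  U `<=` V -> plusplus_part alpha U `<=` plusplus_part alpha V.
Proof.
by move=> /plus_partS UV x [n _ [y /UV Uy <-]]; exists n => //; exists y.
Qed.

Lemma subgroup_plusplus_part U : subgroup U -> subgroup (plusplus_part alpha U).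
Proof.
move=> sU; have sn n := subgroup_iter_image alpha n (subgroup_plus_part sU).
apply/subgroupP; split; first by exists 0%N => //; exact: subgroup1.
move=> x y [m _ xm] [n _ yn]; exists (maxn m n) => //.
by apply: subgroupVM => //; [move: xm | move: yn]; apply: image_plus_part_le;
  rewrite ?leq_maxl ?leq_maxr.
Qed.

(** Points that have a backward orbit eventually in [U] and whose forward orbit is eventually in
    [U]. *)
Definition homoclinic U :=
  plusplus_part alpha U `&` [set x | exists n, minus U (iter n alpha x)].

Lemma homoclinicS U V : U `<=` V -> homoclinic U `<=` homoclinic V.
Proof.
by move=> UV x [/(plusplus_partS UV) Ux [n /(minus_partS UV) Un]]; split=> //;
  exists n.
Qed.

Lemma subgroup_homoclinic U : subgroup U -> subgroup (homoclinic U).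
Proof.
move=> sU; apply: subgroupI; first exact: subgroup_plusplus_part.
have sm := subgroup_minus_part sU; apply/subgroupP; split.
  by exists 0%N; exact: subgroup1.
move=> x y [m xm] [n yn]; exists (m + n)%N; rewrite iter_gmulfVM.
apply: subgroupVM => //; last by rewrite iterD; exact: minus_part_iter.
by rewrite addnC iterD; exact: minus_part_iter.
Qed.

Lemma homoclinic_image U x : homoclinic U x -> homoclinic U (alpha x).
Proof.
move=> [[m _ xm] [n xn]]; split; last first.
  by exists n; rewrite -iterSr; exact: (minus_part_iter 1).
by exists m.+1 => //; rewrite iter_imageS; exists x.
Qed.

Lemma homoclinic_lift U x :
  homoclinic U x -> exists2 y, homoclinic U y & alpha y = x.
Proof.
move=> [[m _ [y /plus_part_lift[z Uz <-] E]] [n xn]].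
rewrite -iterSr iterS in E; exists (iter m alpha z) => //; split; last first.
  by exists n.+1; rewrite iterSr E.
by exists m => //; exists z.
Qed.

Definition forward n U := [set x | forall k, (k <= n)%N -> U (iter k alpha x)].

Lemma forward0 U : forward 0 U = U.
Proof.
by apply/seteqP; split=> x => [/(_ 0%N)|Ux k];
  [apply | rewrite leqn0 => /eqP->].
Qed.

Lemma forwardS n U : forward n.+1 U = forward n U `&` alpha @^-1` (forward n U).
Proof.
apply/seteqP; split=> x.
  move=> H; split=> k kn; first by apply: H; exact: ltnW.
  by rewrite -iterSr; exact: H.
move=> [H0 H1] [|k] kn; first exact: H0.
by rewrite iterSr; exact: H1.
Qed.

Lemma forward_sub n U : forward n U `<=` U.
Proof. by move=> x /(_ 0%N); apply. Qed.

Lemma forward_le m n U : (m <= n)%N -> forward n U `<=` forward m U.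
Proof. by move=> mn x H k km; apply: H; exact: leq_trans mn. Qed.

Lemma forward_iter m n U x :
  forward (m + n) U x -> forward n U (iter m alpha x).
Proof. by move=> H k kn; rewrite -iterD; apply: H; rewrite addnC leq_add2l. Qed.

Lemma subgroup_forward n U : subgroup U -> subgroup (forward n U).
Proof.
move=> sU; elim: n => [|n IH]; first by rewrite forward0.
by rewrite forwardS; apply: subgroupI => //; exact: subgroup_preimage.
Qed.

Lemma minus_partP U x : minus U x <-> forall n, forward n U x.
Proof.
split=> [[Ux Un] n k _ //|H].
by split=> [|n]; [exact: (H 0%N 0%N) | exact: (H n n)].
Qed.

(** Ends of orbit segments of length [n] inside [U]: they decrease to [U_+], just as the starting
    points [forward n U] decrease to [U_-]. *)
Definition backward n U := image n (forward n U).

Lemma backwardS n U : backward n.+1 U `<=` backward n U.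
Proof.
move=> _ [x Hx <-]; exists (alpha x); last by rewrite -iterSr.
by apply: (@forward_iter 1).
Qed.

Lemma plus_part_backward n U : plus U `<=` backward n U.
Proof.
move=> x [Ux [u [Uu u0 uS]]].
have E k m : iter k alpha (u (k + m)%N) = u m.
  by elim: k => // k IH; rewrite addSn iterSr uS.
exists (u n); last by have := E n 0%N; rewrite addn0 u0.
by move=> k kn; have := E k (n - k)%N; rewrite subnKC // => ->.
Qed.

Hypothesis alpha_cont : continuous alpha.
Hypothesis hsG : hausdorff_space G.

Lemma compact_open_forward n U : compact_open_subgroup U ->
  compact_open_subgroup (forward n U).
Proof.
move=> hU; elim: n => [|n [sF cF oF]]; first by rewrite forward0.
have sP := subgroup_preimage alpha sF.
have oP : open (alpha @^-1` (forward n U)).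
  by apply: open_comp => // x _; exact: alpha_cont.
rewrite forwardS; split; [exact: subgroupI | | exact: openI].
by apply: compact_closedI => //; exact: open_subgroup_closed.
Qed.

Lemma backward_compact n U : compact_open_subgroup U -> compact (backward n U).
Proof.
by move=> /(compact_open_forward n)[_ cF _]; exact: iter_image_compact.
Qed.

Lemma backward_closed n U : compact_open_subgroup U -> closed (backward n U).
Proof. by move=> hU; apply: compact_closed => //; exact: backward_compact. Qed.

(** By compactness each point of the intersection of the [backward n U] has a preimage in that
    intersection; dependent choice then builds a backward orbit inside [U]. *)
Lemma backward_plus_part U x : compact_open_subgroup U ->
  (forall n, backward n U x) -> plus U x.
Proof.
move=> hU; pose P := [set x | forall n, backward n U x].
have lift y : P y -> exists z, P z /\ alpha z = y.
  move=> Py; pose E n := backward n U `&` alpha @^-1` [set y].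
  have cl n : closed (E n).
    apply: closedI; first exact: backward_closed.
    apply: preimage_closed; first by move=> ? _; exact: alpha_cont.
    by apply: accessible_closed_set1; exact: hausdorff_accessible.
  have [|n|n|z Ez] := nested_compact cl.
  - apply: (subclosed_compact (cl 0%N) (@backward_compact 0 _ hU)).
    by move=> z [].
  (* The last point but one of a segment of length [n + 1] ending in [y] ends a segment of length
     [n]. *)
  - have [w Fw wy] := Py n.+1; exists (iter n alpha w); split=> //.
    by exists w => //; exact: forward_le Fw.
  - by move=> w [/backwardS Bw aw].
  by exists z; split=> [n|]; [have [] := Ez n | have [] := Ez 0%N].
move=> Px.
have liftT (y : {z | P z}) : {z : {z | P z} | alpha (sval z) = sval y}.
  apply: cid; have [z [Pz E]] := lift _ (svalP y).
  by exists (exist _ z Pz).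
have [u [u0 uS]] := dependent_choice liftT (exist _ x Px).
have PU y : P y -> U y by move=> /(_ 0%N)[z /forward_sub Uz <-].
split; first exact: PU.
exists (fun n => sval (u n)); split=> [n||n]; last exact: uS.
  by apply: PU; exact: svalP.
by rewrite u0.
Qed.

Lemma plus_part_compact U : compact_open_subgroup U -> compact (plus U).
Proof.
move=> hU; rewrite (_ : plus U = \bigcap_n backward n U).
  apply: (subclosed_compact _ (@backward_compact 0 _ hU)); last first.
    by move=> x; apply.
  by apply: closed_bigI => n _; exact: backward_closed.
apply/seteqP; split=> x; first by move=> Ux n _; exact: plus_part_backward.
by move=> H; apply: backward_plus_part => // n; exact: H.
Qed.

(* With [V := W /\ alpha^-1 W], the map induced by [alpha] from
   [alpha V / (alpha V /\ V)] to [alpha W / (alpha W /\ W)] is injective. *)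
Lemma displacement_index_forward W : compact_open_subgroup W ->
  (displacement_index alpha (forward 1 W) <= displacement_index alpha W)%N /\
  ((displacement_index alpha W <= displacement_index alpha (forward 1 W))%N ->
  forall w, W w -> exists a b,
    [/\ backward 1 W a, forward 1 W b & w = a * b]).
Proof.
move=> hW; have [sW cW _] := hW.
pose V := forward 1 W.
have hV : compact_open_subgroup V by exact: compact_open_forward.
have [sV _ _] := hV.
have VP x : V x <-> W x /\ W (alpha x).
  by rewrite /V forwardS forward0.
have [|||_ [x Vx <-]|_ _ _ _ [u Vu <-] [v Vv <-] _ _ <- <- [_]|_ le onto] :=
  @index_map _ (fun x x' => alpha x = x') (alpha @` V) (alpha @` V `&` V)
    (alpha @` W) (alpha @` W `&` W).
- by solve_subgroup.
- by solve_subgroup.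
- exact: (finite_displacement alpha_cont 1).
- by exists (alpha (alpha x)) => //; exists (alpha x) => //; have /VP[] := Vx.
- have /VP[Wu Wau] := Vu; have /VP[Wv Wav] := Vv.
  rewrite -!gmulfV -!gmulfM => Ww; split.
    by exists (u^-1 * v) => //; exact: (subgroupVM sV).
  apply/VP; split=> //; rewrite gmulfM gmulfV; exact: subgroupVM.
split=> // /onto H w Ww; have [|x [_ [[y Vy <-] _ <- [_]]]] := H (alpha w).
  by exists w.
have /VP[Wy Way] := Vy.
rewrite -gmulfV -gmulfM => Wx; exists (alpha y), ((alpha y)^-1 * w); split.
- by exists y.
- by apply/VP; split=> //; exact: subgroupVM.
by rewrite mulVKg.
Qed.

(** Minimality forces equality in [displacement_index_forward] for every [forward n U]. The
    resulting factorizations combine to [U = backward m U * forward n U] for all [m] and [n], and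
    compactness gives the limit. *)
Lemma minimal_TA (C : set (set G)) U :
  (forall W, C W -> compact_open_subgroup W) ->
  (forall W, C W -> C (forward 1 W)) ->
  C U ->
  (forall W, C W ->
    (displacement_index alpha U <= displacement_index alpha W)%N) ->
  TA alpha U.
Proof.
move=> CH CF CU minU; have hU := CH _ CU; have [sU cU oU] := hU.
have sF n := @subgroup_forward n U sU.
have CFn n : C (forward n U).
  elim: n => [|n IH]; first by rewrite forward0.
  by rewrite forwardS; have := CF _ IH; rewrite forwardS forward0.
have dF n :
    (displacement_index alpha (forward n U) <= displacement_index alpha U)%N.
  elim: n => [|n IH]; first by rewrite forward0.
  have [le _] := displacement_index_forward (CH _ (CFn n)).
  by apply: leq_trans IH; move: le; rewrite !forwardS forward0.
have step n w : forward n U w -> exists a b,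
    [/\ backward 1 (forward n U) a, forward n.+1 U b & w = a * b].
  have [_ onto] := displacement_index_forward (CH _ (CFn n)).
  move=> Fw; have [|a [b [aP bP ->]]] := onto _ w Fw.
    by apply: leq_trans (dF n) _; apply: minU; exact/CF/CFn.
  exists a, b; split=> //; rewrite forwardS.
  by move: bP; rewrite forwardS forward0.
have sB1 n : subgroup (backward 1 (forward n U)).
  by apply: subgroup_iter_image; exact: subgroup_forward.
(* The left factors accumulate in the subgroup [backward 1 (forward m U)], because
   [forward (m + k) U] lies in [forward m U], while the right factor gets deeper. *)
have steps m k w : forward m U w -> exists a b,
    [/\ backward 1 (forward m U) a, forward (m + k) U b & w = a * b].
  move=> Fw; elim: k => [|k [a [b [aP bP ->]]]].
    by exists 1, w; rewrite addn0 mul1g; split=> //; exact: subgroup1.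
  have [a' [b' [[c Fc <-] b'P ->]]] := step _ _ bP.
  exists (a * alpha c), b'; rewrite addnS mulgA; split=> //.
  apply: subgroupM => //; exists c => //.
  by move=> i /Fc; apply: forward_le; exact: leq_addr.
have fact m n x : U x ->
    exists a b, [/\ backward m U a, forward n U b & x = a * b].
  elim: m n x => [|m IH] n x Ux.
    exists x, 1; rewrite mulg1; split=> //; last exact: subgroup1.
    by exists x => //; rewrite forward0.
  have [_ [b [[y Fy <-] bP ->]]] := IH n x Ux.
  (* The right factor [d] is taken in [forward (m + n) U], so that [alpha^m] still sends it into
     [forward n U]. *)
  have [c [d [[e Fe <-] dP ->]]] := steps m n y Fy.
  exists (iter m.+1 alpha e), (iter m alpha d * b); split.
  - exists e => //; rewrite forwardS; move: Fe.
    by rewrite forwardS forward0 => -[Fe Fae].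
  - by apply: (subgroupM (sF n)) => //; exact: forward_iter.
  by rewrite iter_gmulfM mulgA -iterSr.
apply/seteqP; split=> [x Ux|_ [a aP [b bP <-]]]; last first.
  by apply: subgroupM => //; [exact: plus_part_sub | exact: minus_part_sub].
(* The left factors of [x] admissible at level [n]; one admissible at all levels lies in [U_+] and
   leaves a right factor in [U_-]. *)
pose E n := backward n U `&` [set a | forward n U (a^-1 * x)].
have cl n : closed (E n).
  apply: closedI; first exact: backward_closed.
  apply: (@preimage_closed _ _ (fun a => a^-1 * x)); last first.
    by have [? _ ?] := CH _ (CFn n); exact: open_subgroup_closed.
  move=> a _; apply: (@continuous_comp _ _ _ (fun a => a^-1) (fun a => a * x)).
    exact: invg_continuous.
  exact: mulg_continuousr.
have [|n|n|a Ea] := nested_compact cl.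
- by apply: (subclosed_compact (cl 0%N) (@backward_compact 0 _ hU)) => ? [].
- have [a [b [aP bP xE]]] := fact n n x Ux.
  by exists a; split=> //=; rewrite xE mulKg.
- by move=> a [/backwardS Ba /= Fa]; split=> //= k kn; apply: Fa; exact: leqW.
exists a; first by apply: backward_plus_part => // n; have [] := Ea n.
exists (a^-1 * x); last by rewrite mulVKg.
by apply/minus_partP => n; have [] := Ea n.
Qed.

End Parts.

Section FiniteFamilies.
Variables (X : topologicalType) (T : finType) (F : T -> set X).

Lemma finite_forall_open :
  (forall i, open (F i)) -> open [set x | forall i, F i x].
Proof.
move=> oF; rewrite (_ : mkset _ = \big[setI/setT]_(i <- enum T) F i).
  by apply: big_ind => //; [exact: openT | exact: openI].
rewrite -bigcap_seq; apply/seteqP; split=> x H i => [_|]; first exact: H.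
by apply: H => /=; rewrite mem_enum.
Qed.

Lemma finite_exists_compact :
  (forall i, compact (F i)) -> compact [set x | exists i, F i x].
Proof.
move=> cF; rewrite (_ : mkset _ = \big[setU/set0]_(i <- enum T) F i).
  exact: bigsetU_compact.
rewrite -bigcup_seq; apply/seteqP; split=> x [i].
  by move=> Fx; exists i => //=; rewrite mem_enum.
by move=> _ Fx; exists i.
Qed.

End FiniteFamilies.

(** * Ascending chains of images [alpha^n S] and their indices *)

Section Chains.
Variables (G : topologicalGroupType) (alpha : UMagmaMorphism.type G G).
Implicit Types (A B S U V W : set G) (x y : G).
Local Notation image n := (iter_image alpha n).

Definition step_index S n := subgroup_index (image n.+1 S) (image n S).

Section Chain.
Variable S : set G.
Hypotheses (sS : subgroup S) (SaS : S `<=` alpha @` S)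
  (finS : finite_index (alpha @` S) S).

Lemma chainS n : image n S `<=` image n.+1 S.
Proof.
by move=> _ [x /SaS[y Sy <-] <-]; exists y => //; rewrite iterSr.
Qed.

Lemma chain_le m n : (m <= n)%N -> image m S `<=` image n S.
Proof.
elim: n => [|n IH]; first by rewrite leqn0 => /eqP->.
rewrite leq_eqVlt => /predU1P[->//|/IH mn x /mn].
exact: chainS.
Qed.

Let sI n : subgroup (image n S). Proof. exact: subgroup_iter_image. Qed.

Lemma finite_step_index n :
  finite_index (image n.+1 S) (image n S) /\
  (step_index S n.+1 <= step_index S n)%N.
Proof.
have f0 k : finite_index (image k.+1 S) (image k S).
  elim: k => [|k IH]; first by rewrite [X in finite_index _ X]image_id.
  rewrite !(iter_imageS _ k) (iter_imageS _ k.+1).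
  by have [] := index_image alpha (sI k) IH.
split=> //; have [_] := index_image alpha (sI n) (f0 n).
by rewrite -!iter_imageS.
Qed.

Lemma step_index_le m n : (m <= n)%N -> (step_index S n <= step_index S m)%N.
Proof.
elim: n => [|n IH]; first by rewrite leqn0 => /eqP->.
rewrite leq_eqVlt => /predU1P[->//|/IH]; apply: leq_trans.
by have [] := finite_step_index n.
Qed.

Lemma chain_index n : finite_index (image n S) S /\
  subgroup_index (image n S) S = (\prod_(k < n) step_index S k)%N.
Proof.
elim: n => [|n [fn En]].
  have -> : image 0 S = S by exact: image_id.
  rewrite big_ord0 index_self //; split=> //.
  apply: (@finite_index_cover _ _ _ unit (fun=> 1)) => // x Sx.
  by exists tt; rewrite invg1 mul1g.
have [f1 _] := finite_step_index n.
have S0 : S `<=` image n S.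
  by have := chain_le (leq0n n); rewrite [image 0 S]image_id.
have [f E] := index_mul (sI n.+1) (sI n) sS S0 (@chainS n) f1 fn.
by split=> //; rewrite E En big_ord_recr mulnC.
Qed.

(* The quotient map induced by [alpha] between consecutive steps is onto; it is
   injective as soon as the two indices agree. *)
Lemma step_index_inj n x : step_index S n = step_index S n.+1 ->
  image n.+1 S x -> image n.+1 S (alpha x) -> image n S x.
Proof.
move=> E Sx Sax; pose D := image n.+1 S `&` alpha @^-1` (image n.+1 S).
have sD : subgroup D by apply: subgroupI => //; exact: subgroup_preimage.
have SD : image n S `<=` D.
  move=> y Sy; split; first exact: chainS.
  by rewrite /= iter_imageS; exists y.
have [f1 _] := finite_step_index n.
have [f2 l2] : finite_index D (image n S) /\
    (subgroup_index D (image n S) <= step_index S n)%N.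
  apply: index_sub => //; first by move=> y [].
  by move=> y z; exact: subgroupVM.
have [f3 l3] : finite_index (image n.+1 S) D /\
    (subgroup_index (image n.+1 S) D <= step_index S n)%N.
  apply: index_sub => //; first by move=> y [_]; exact: SD.
  by move=> y z; exact: subgroupVM.
have le : (step_index S n.+1 <= subgroup_index (image n.+1 S) D)%N.
  have [//|y Sy|y z y' z' _ _ Sy' Sz' <- <- [_ /=]|_ le _] :=
    @index_map _ (fun y x => alpha x = y) (image n.+2 S) (image n.+1 S)
      (image n.+1 S) D (sI _) sD.
  - by move: Sy; rewrite iter_imageS => -[x' ? <-]; exists x'.
  - by rewrite gmulfM gmulfV.
  exact: le.
have DA : D `<=` image n.+1 S by move=> y [].
have [_ EE] := index_mul (sI n.+1) sD (sI n) SD DA f3 f2.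
apply: (index_le1 sD (sI n) f2) => //.
move: le; rewrite -E /step_index EE => le.
have g0 : (0 < subgroup_index (image n.+1 S) D)%N by exact: index_gt0.
by rewrite -(leq_pmul2l g0) muln1.
Qed.

End Chain.

Hypothesis alpha_cont : continuous alpha.

(** For [v = p * q] the point [alpha^n q] lies in [V], so [alpha^n p] represents the coset of
    [alpha^n v], and the inclusion of [alpha^n P] in [alpha^n V] is bijective on cosets. *)
Lemma displacement_factor n P V : compact_open_subgroup V -> subgroup P ->
  P `<=` V ->
  (forall v, V v -> exists p q, [/\ P p, minus_part alpha V q & v = p * q]) ->
  finite_index (image n P) (image n P `&` V) /\
  displacement alpha n V = subgroup_index (image n P) (image n P `&` V).
Proof.
move=> hV sP PV fact; have [sV cV _] := hV.
have fV := finite_displacement alpha_cont n hV cV sV.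
have sPV : subgroup (image n P `&` V) by solve_subgroup.
have sVV : subgroup (image n V `&` V) by solve_subgroup.
have PVn : image n P `<=` image n V by exact: image_subset.
have [||fP lP] := index_sub sPV sVV fV PVn.
- by move=> x [? []].
- by move=> x y; apply: subgroupVM; exact: subgroup_iter_image.
split=> //; apply/eqP; rewrite eqn_leq lP andbT.
have [|x y x' y' Ax Ay _ _ Rx Ry [_ Vxy]|_ le _] :=
  @index_map _ (fun x y => V (y^-1 * x)) (image n V) (image n V `&` V)
    (image n P) (image n P `&` V) sVV sPV fP; last exact: le.
  move=> _ [v /fact[p [q [Pp [_ Vq] ->]]] <-]; exists (iter n alpha p);
    first by exists p.
  by rewrite iter_gmulfM mulKg.
split; first by apply: subgroupVM => //; exact: subgroup_iter_image.
rewrite (_ : x^-1 * y = (x'^-1 * x)^-1 * (x'^-1 * y') * (y'^-1 * y));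
  last first.
  by rewrite ?gnorm.
by apply: subgroupM => //; exact: subgroupVM.
Qed.

(** Since [alpha^n H /\ V = H], the index [d_n V] equals [[alpha^n H : H]], a product of [n] equal
    step indices. *)
Lemma displacement_exp H V :
  compact_open_subgroup V -> subgroup H -> H `<=` V ->
  H `<=` alpha @` H ->
  (forall v, V v -> exists p q, [/\ H p, minus_part alpha V q & v = p * q]) ->
  (forall n, image n H `&` V `<=` H) ->
  (forall n, step_index H n = step_index H 0) ->
  forall n, displacement alpha n V = (displacement_index alpha V ^ n)%N.
Proof.
move=> hV sH HV HaH fact HI stepE.
have [sV cV _] := hV.
have finH : finite_index (alpha @` H) H.
  have [] // := @index_sub _ (alpha @` H) H (alpha @` V) (alpha @` V `&` V);
    try solve_subgroup.
  - exact: (finite_displacement alpha_cont 1).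
  - exact: image_subset.
  - by move=> x [Hx [_ Vx]]; exact: (HI 1%N).
  - by move=> x y; apply: subgroupVM; exact: subgroup_image.
have dE n : displacement alpha n V = (step_index H 0 ^ n)%N.
  have [_ ->] := displacement_factor n hV sH HV fact.
  rewrite (_ : image n H `&` V = H).
    have [_ ->] := chain_index sH HaH finH n.
    under eq_bigr do rewrite stepE.
    by rewrite prod_nat_const card_ord.
  apply/seteqP; split=> x Hx; first exact: (HI n).
  split; last exact: HV.
  by apply: (chain_le HaH (leq0n n)); rewrite [image 0 H]image_id.
by move=> n; rewrite -displacement1 !dE expn1.
Qed.

End Chains.

(** * Finiteness of the index of [U_+] in its image and of the homoclinic group modulo [U] *)

Section Plus.
Variables (G : topologicalGroupType) (alpha : UMagmaMorphism.type G G).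
Hypothesis alpha_cont : continuous alpha.
Implicit Types (A B U V W : set G) (x y : G).
Local Notation plus := (plus_part alpha).
Local Notation minus := (minus_part alpha).
Local Notation image n := (iter_image alpha n).

Lemma plus_part_sub_image U : plus U `<=` alpha @` plus U.
Proof. by move=> x /plus_part_lift[y]; exists y. Qed.

Lemma image_plus_part_cap U : alpha @` plus U `&` U = plus U.
Proof.
apply/seteqP; split=> x.
  by move=> [[y Uy <-] Uay]; exact: plus_part_image.
by move=> Ux; split; [exact: plus_part_sub_image | exact: plus_part_sub Ux].
Qed.

Lemma finite_index_plus_part U : compact_open_subgroup U ->
  finite_index (alpha @` plus U) (plus U).
Proof.
move=> hU; have [sU cU _] := hU; have sP := subgroup_plus_part alpha sU.
have [] // :=
  @index_sub _ (alpha @` plus U) (plus U) (alpha @` U) (alpha @` U `&` U).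
- by solve_subgroup.
- exact: (finite_displacement alpha_cont 1).
- by apply: image_subset; exact: plus_part_sub.
- by rewrite -[X in _ `<=` X]image_plus_part_cap => x [? []].
- by move=> x y; apply: subgroupVM; exact: subgroup_image.
Qed.

Lemma TA_factor U : TA alpha U -> forall v, U v ->
  exists p q, [/\ plus U p, minus U q & v = p * q].
Proof. by move=> E v; rewrite {1}E => -[p Pp [q Qq <-]]; exists p, q. Qed.

(* Write [alpha(L_+) = F L_+] with [F] finite in [L := homoclinic U], and choose
   [p] such that [alpha^p(F)] lies in [U_-]: then
   [alpha^n(L_+) = alpha^(n-1)(F) ... alpha(F) F L_+] lies in [U_- alpha^p(U_+)]
   for all [n], hence so does [L]. *)
Lemma finite_index_homoclinic U : compact_open_subgroup U ->
  finite_index (homoclinic alpha U) (homoclinic alpha U `&` U).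
Proof.
move=> hU; have [sU cU oU] := hU.
pose L := homoclinic alpha U.
have sL : subgroup L by exact: subgroup_homoclinic.
have sP := subgroup_plus_part alpha sU; have sM := subgroup_minus_part alpha sU.
pose Lp := L `&` plus U; have sLp : subgroup Lp by exact: subgroupI.
have saLp := subgroup_image alpha sLp.
have [||||||f _] := @index_sub _ (alpha @` Lp) Lp (alpha @` plus U) (plus U).
- by [].
- by [].
- exact: finite_index_plus_part.
- by apply: image_subset => x [].
- by move=> _ [[x [Lx _] <-] Ux]; split=> //; exact: homoclinic_image.
- by move=> x y; exact: subgroupVM.
have [T [t [[tA cov _] _]]] := transversal_exists sLp f.
have tM i : exists n, minus U (iter n alpha (t i)).
  by have [x [/homoclinic_image[_ [n H]] _] <-] := tA i; exists n.
have [h hP] := choice tM; pose p := \max_i h i.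
have tp i n : (p <= n)%N -> minus U (iter n alpha (t i)).
  move=> pn; have hn : (h i <= n)%N by apply: leq_trans pn; exact: leq_bigmax.
  by rewrite -(subnK hn) iterD; exact: minus_part_iter.
have key n x : Lp x -> exists a b,
    [/\ minus U a, image p (plus U) b & iter n alpha x = a * b].
  elim: n x => [|n IH] x Lx.
    exists 1, x; rewrite mul1g; split=> //; first exact: subgroup1.
    by apply: (image_plus_part_le (leq0n p)); exists x => //; case: Lx.
  have [np|pn] := ltnP n p.
    exists 1, (iter n.+1 alpha x); rewrite mul1g; split=> //;
      first exact: subgroup1.
    by apply: (image_plus_part_le np); exists x => //; case: Lx.
  have [|i Li] := cov (alpha x); first by exists x.
  have [a [b [Ma Pb E]]] := IH _ Li.
  exists (iter n alpha (t i) * a), b; split=> //.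
    by apply: subgroupM => //; exact: tp.
  by rewrite -mulgA -E iter_gmulfVM mulVKg iterSr.
(* The relation is equality of left cosets of [U]: it embeds [L/(L /\ U)] in the finite
   [alpha^p U/(alpha^p U /\ U)]. *)
have [|||x Lx|x y x' y' Lx Ly _ _ Rx Ry [_ Uxy]|fL _ _] :=
  @index_map _ (fun x y => U (y^-1 * x)) L (L `&` U)
    (image p U) (image p U `&` U).
- by solve_subgroup.
- by solve_subgroup.
- exact: finite_displacement.
(* [key] puts the factor from [U] on the left; applying it to [x^-1] and inverting moves that factor
   to the right. *)
- have [[m _ [y Py E]] Mx] := subgroupV sL Lx.
  have Ly : Lp y.
    split=> //; split; first by exists 0%N => //; exists y.
    by case: Mx => n; rewrite -E -iterD; exists (n + m)%N.
  have [a [b [Ma Pb]]] := key m y Ly; rewrite E => xE.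
  exists b^-1.
    apply: subgroupV; first exact: subgroup_iter_image.
    by case: Pb => z /plus_part_sub Uz <-; exists z.
  rewrite invgK -[x]invgK xE invgM mulVKg; apply: subgroupV => //.
  exact: minus_part_sub Ma.
- split; first exact: subgroupVM.
  rewrite (_ : x^-1 * y = (x'^-1 * x)^-1 * (x'^-1 * y') * (y'^-1 * y));
    last first.
    by rewrite ?gnorm.
  by apply: subgroupM => //; exact: subgroupVM.
exact: fL.
Qed.

End Plus.

Lemma exists_minimal (T : Type) (C : set T) (f : T -> nat) : C !=set0 ->
  exists2 x, C x & forall y, C y -> (f x <= f y)%N.
Proof.
move=> [x0 Cx0]; have ex : exists n, `[< exists2 x, C x & f x = n >].
  by exists (f x0); apply/asboolP; exists x0.
case: (ex_minnP ex) => n /asboolP[x Cx <-] minn; exists x => // y Cy.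
by apply: minn; apply/asboolP; exists y.
Qed.

(** * Subgroups normalized by homoclinic points, and a multiplicative displacement *)

Section Existence.
Variables (G : topologicalGroupType) (alpha : UMagmaMorphism.type G G).
Hypothesis alpha_cont : continuous alpha.
Hypothesis hsG : hausdorff_space G.
Implicit Types (A B U V W : set G) (x y : G).
Local Notation plus := (plus_part alpha).
Local Notation minus := (minus_part alpha).
Local Notation image n := (iter_image alpha n).
Local Notation homoclinic := (homoclinic alpha).

Lemma open_subgroup_sup A U : subgroup A -> open U -> subgroup U -> U `<=` A ->
  open A.
Proof.
move=> sA oU sU UA; rewrite (_ : A = \bigcup_(a in A) [set z | U (a^-1 * z)]).
  by apply: bigcup_open => a _; exact: open_translate.
apply/seteqP; split=> [a Aa|z [a Aa /= /UA Az]].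
  by exists a => //=; rewrite mulVg; exact: subgroup1.
by rewrite -[z](mulVKg a); exact: subgroupM.
Qed.

(** The compact open subgroups of [U] normalized by [L := homoclinic U] form a class stable under
    [forward 1], because [alpha] maps [L] into [L]; [minimal_TA] applies to a member of least
    displacement. *)
Lemma exists_normalized_TA U : compact_open_subgroup U -> exists N,
  [/\ compact_open_subgroup N, N `<=` U,
      forall l x, homoclinic U l -> N x -> N (x ^ l) & TA alpha N].
Proof.
move=> hU; have [sU cU oU] := hU; have clU := open_subgroup_closed sU oU.
have sL := subgroup_homoclinic alpha sU.
pose C N := [/\ compact_open_subgroup N, N `<=` U &
  forall l x, homoclinic U l -> N x -> N (x ^ l)].
(* The intersection of the conjugates of [U] under [L] belongs to the class: it is open because
   [L /\ U] has finite index in [L], so that finitely many conjugates suffice. *)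
suff C0 : C [set x | forall l, homoclinic U l -> U (x ^ l)].
  have [N CN minN] :=
    exists_minimal (displacement_index alpha) (ex_intro C _ C0).
  have [hN NU Nl] := CN; exists N; split=> //.
  apply: (minimal_TA alpha_cont hsG (C := C)) => // [W [] //|W [hW WU Wl]].
  split; first exact: compact_open_forward.
    by move=> x /forward_sub; exact: WU.
  move=> l x Ll; rewrite forwardS forward0 => -[Wx Wax]; split; first exact: Wl.
  by rewrite /= gmulfJ; apply: Wl => //; exact: homoclinic_image.
set N := (X in C X).
have sN : subgroup N.
  apply/subgroupP; split=> [l _|x y Nx Ny l Ll].
    by rewrite conj1g; exact: subgroup1.
  by rewrite conjMg conjVg; apply: subgroupVM => //; [exact: Nx | exact: Ny].
have NU : N `<=` U by move=> x /(_ 1); rewrite conjg1; apply; exact: subgroup1.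
have sLU : subgroup (homoclinic U `&` U) by exact: subgroupI.
have [T [t [[tA cov _] _]]] :=
  transversal_exists sLU (finite_index_homoclinic alpha_cont hU).
have oN : open N.
  rewrite (_ : N = [set x | forall i, U (x ^ t i)]).
    apply: finite_forall_open => i;
      apply: (@open_comp _ _ (fun x => x ^ t i)) => // x _.
    apply: (@continuous_comp _ _ _ (fun x => x * t i) (fun y => (t i)^-1 * y)).
      exact: mulg_continuousr.
    exact: mulg_continuousl.
  apply/seteqP; split=> [x Nx i|x Ux l Ll]; first exact: Nx.
  have [i [_ Ui]] := cov l Ll.
  rewrite -[l](mulVKg (t i)) conjgM conjgE.
  by apply: subgroupVM => //; apply: subgroupM => //; exact: Ux.
split=> //; last first.
  move=> k x Lk Nx l Ll; rewrite -conjgM; apply: Nx; exact: subgroupM.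
split=> //; apply: subclosed_compact cU NU.
exact: open_subgroup_closed.
Qed.

(* For [H := N_{++} /\ V = N_+ L] one has [V = H V_-], and [alpha] is injective
   on the [H]-cosets of [N_{++}] because [L] contains its kernel there. *)
Lemma exists_multiplicative U : compact_open_subgroup U -> exists V,
  compact_open_subgroup V /\
  forall n, displacement alpha n V = (displacement_index alpha V ^ n)%N.
Proof.
move=> /exists_normalized_TA[N [hN NU NL /TA_factor fact]].
have [sN cN oN] := hN; pose L := homoclinic N.
have {}NL l x : L l -> N x -> N (x ^ l) by move=> /(homoclinicS NU); exact: NL.
have sL : subgroup L by exact: subgroup_homoclinic.
pose V := [set x * l | x in N & l in L].
have NV : N `<=` V.
  by move=> x Nx; exists x => //; exists 1; rewrite ?mulg1 //; exact: subgroup1.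
have LV : L `<=` V.
  by move=> l Ll; exists 1; [exact: subgroup1 | exists l; rewrite ?mul1g].
have sV : subgroup V.
  apply/subgroupP; split; first by apply: NV; exact: subgroup1.
  move=> _ _ [x Nx [l Ll <-]] [y Ny [m Lm <-]].
  exists ((x^-1 * y) ^ l); first by apply: NL => //; exact: subgroupVM.
  exists (l^-1 * m); first exact: subgroupVM.
  by rewrite conjgE ?gnorm.
have oV : open V by exact: open_subgroup_sup oN sN NV.
(* [V] lies in finitely many translates of [N], as [L /\ N] has finite index in [L]. *)
have hV : compact_open_subgroup V.
  split=> //; have sLN : subgroup (L `&` N) by exact: subgroupI.
  have [T [t [[tA cov _] _]]] :=
    transversal_exists sLN (finite_index_homoclinic alpha_cont hN).
  apply: (@subclosed_compact _ _ [set x | exists i, [set t i * y | y in N] x]).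
  - exact: open_subgroup_closed.
  - apply: finite_exists_compact => i; apply: continuous_compact => //.
    by apply: continuous_subspaceT; exact: mulg_continuousl.
  move=> _ [x Nx [l Ll <-]]; have [i [_ Ni]] := cov l Ll.
  exists i, ((t i)^-1 * l * x ^ l); first by apply: subgroupM => //; exact: NL.
  by rewrite conjgE ?gnorm.
pose Npp := plusplus_part alpha N.
have sNpp : subgroup Npp by exact: subgroup_plusplus_part.
pose H := Npp `&` V; have sH : subgroup H by exact: subgroupI.
have NpN : plus N `<=` Npp by move=> x Nx; exists 0%N => //; exists x.
have aNpp x : Npp x -> Npp (alpha x).
  by move=> [n _ Nx]; exists n.+1 => //; rewrite iter_imageS; exists x.
have NpH : plus N `<=` H.
  by move=> x Nx; split; [exact: NpN | exact: NV (plus_part_sub Nx)].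
have LH : L `<=` H by move=> x Lx; split; [case: Lx | exact: LV].
(* In [w = p * q * l] the factor [q] of [N_-] equals [p^-1 * w * l^-1], hence lies in [N_{++}] and
   is homoclinic to [N]. *)
have Hfact w : H w -> exists p l, [/\ plus N p, L l & w = p * l].
  move=> [Nw [v Nv [l Ll vl]]]; have [p [q [Np Nq vpq]]] := fact _ Nv.
  exists p, (q * l); rewrite mulgA -vpq vl; split=> //; apply: subgroupM => //.
  split; last by exists 0%N.
  rewrite (_ : q = p^-1 * (w * l^-1)); last by rewrite -vl mulgK vpq mulKg.
  apply: subgroupVM => //; first exact: NpN.
  by apply: subgroupM => //; apply: subgroupV => //; case: Ll.
have HaH : H `<=` alpha @` H.
  move=> w /Hfact[p [l [/plus_part_lift[p' Np <-]]]].
  move=> /homoclinic_lift[l' Ll <-] ->; exists (p' * l'); last exact: gmulfM.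
  by apply: subgroupM => //; [exact: NpH | exact: LH].
have imNpp n : image n H `<=` Npp.
  by move=> _ [x [Nx _] <-]; elim: n => // n; exact: aNpp.
exists V; split=> //; apply: (displacement_exp alpha_cont (H := H)) => //.
- by move=> x [].
- move=> _ [x Nx [l Ll <-]]; have [p [q [Np Nq ->]]] := fact _ Nx.
  exists p, (q * l); rewrite mulgA; split=> //; first exact: NpH.
  have iV n : V (iter n alpha (q * l)).
    rewrite iter_gmulfM; apply: subgroupM => //.
      by apply: NV; case: Nq => _; apply.
    by apply: LV; elim: n => // n; exact: homoclinic_image.
  by split=> //; exact: (iV 0%N).
- by move=> n x [/imNpp].
move=> n; have fH : finite_index (alpha @` H) H.
  have [] // := @index_sub _ (alpha @` H) H (alpha @` V) (alpha @` V `&` V);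
    try solve_subgroup.
  - by case: hV => _ cV _; exact: (finite_displacement alpha_cont 1).
  - by apply: image_subset => x [].
  - by move=> x [Hx [_ Vx]]; split=> //; exact: (imNpp 1%N).
  - by move=> x y; apply: subgroupVM; exact: subgroup_image.
apply/eqP; rewrite eqn_leq (step_index_le sH fH (leq0n n)) /=.
have [fn _] := finite_step_index sH fH n.
have H0 : image 0 H = H by exact: image_id.
(* Injectivity of [alpha^n] on the cosets of [H] in [alpha H] shows that step index [n] is not below
   step index [0]. *)
have [|x Hx|x y _ _ Hx Hy _ _ <- <-|_ le _] :=
  @index_map _ (fun x y => iter n alpha x = y) (image 1 H) (image 0 H)
    (image n.+1 H) (image n H) _ (subgroup_iter_image alpha n sH) fn;
      last exact: le.
- by rewrite H0.
- move: Hx => [y Hy <-]; exists (iter n alpha (alpha y)) => //.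
  by exists y => //; rewrite iterSr.
rewrite H0 -iter_gmulfVM => -[h Hh E].
have sI1 := subgroup_iter_image alpha 1 sH.
have Nxy : Npp (x^-1 * y) by apply: (imNpp 1%N); exact: subgroupVM.
rewrite -[x^-1 * y](mulVKg h); apply: subgroupM => //; apply: LH.
split; first by apply: subgroupVM => //; case: Hh.
exists n; rewrite iter_gmulfVM E mulVg;
  exact: subgroup1 (subgroup_minus_part alpha sN).
Qed.

End Existence.

(** * A Baire argument for ascending chains of closed subgroups *)

Section Baire.
Variable G : topologicalGroupType.
Hypothesis hsG : hausdorff_space G.
Implicit Types (A O W : set G) (x y : G).

(** Regularity: with neighbourhoods [A] of [x] and [B] of [1] such that [A * B] lies in [O], each
    point in the closure of [A] is in [A * B]. *)
Lemma nbhs_closure_sub x O : open O -> O x ->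
  exists W, [/\ open W, W x & closure W `<=` O].
Proof.
move=> oO Ox; have [|[A B] /= [nA nB] AB] := @mulg_continuous G (x, 1) O.
  by rewrite /= mulg1; exact: open_nbhs_nbhs.
exists A°; split; [exact: open_interior | exact: nA |] => z clz.
have [|a [/interior_subset Aa /= Ba]] := clz [set a | B (a^-1 * z)].
  apply: (@continuous_comp _ _ _ (fun a => a^-1) (fun a => a * z)).
  - exact: invg_continuous.
  - exact: mulg_continuousr.
  by rewrite /= mulVg.
by rewrite -[z](mulVKg a); exact: (AB (a, a^-1 * z)).
Qed.

(** A [K n] containing a nonempty relatively open part of the compact union [Q] has finite index in
    [Q], and the chain stops. Otherwise shrinking open sets avoid the [K n] in turn, and their
    closures share a point of [Q] outside every [K n]. *)
Lemma ascending_subgroups_stationary (K : nat -> set G) :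
  (forall n, subgroup (K n)) -> (forall n, closed (K n)) ->
  (forall n, K n `<=` K n.+1) -> compact (\bigcup_n K n) ->
  exists N, forall n, K n `<=` K N.
Proof.
move=> sK clK KS; set Q := \bigcup_n K n => cQ; apply: contrapT => nN.
have Kle m n : (m <= n)%N -> K m `<=` K n.
  elim: n => [|n IH]; first by rewrite leqn0 => /eqP->.
  by rewrite leq_eqVlt => /predU1P[->//|/IH mn x /mn /KS].
have KQ n : K n `<=` Q by move=> x; exists n.
have meager n x O : Q x -> open O -> O x -> exists y, [/\ Q y, O y & ~ K n y].
  move=> Qx oO Ox; apply: contrapT => nQ.
  have QO y : Q y -> O y -> K n y.
    by move=> Qy Oy; apply: contrapT => nK; apply: nQ; exists y.
  have fQ : finite_index Q (K n).
    (* For [x * (y^-1 * z)] in [O], both this product and [x] lie in [K n], hence so does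
       [y^-1 * z]. *)
    apply: (@finite_index_compact _ _ _ [set z | O (x * z)]) => //.
    - by apply: open_comp => // z _; exact: mulg_continuousl.
    - by rewrite /= mulg1.
    move=> y z [i _ Ky] [j _ Kz] /= Oyz; case: (Qx) => k _ Kx.
    rewrite -[y^-1 * z](mulKg x); apply: subgroupVM => //; first exact: QO.
    apply: QO => //; exists (maxn (maxn i j) k) => //.
    apply: subgroupM => //; first by apply: Kle Kx; exact: leq_maxr.
    apply: subgroupVM => //; [apply: Kle Ky | apply: Kle Kz]; lia.
  have [T [t [[tQ cov _] _]]] := transversal_exists (sK n) fQ.
  have tK i : exists k, K k (t i) by have [k _ Kt] := tQ i; exists k.
  have [h hP] := choice tK.
  apply: nN; exists (maxn n (\max_i h i)) => m y /KQ /cov[i Ki].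
  rewrite -[y](mulVKg (t i)); apply: subgroupM => //.
    by apply: Kle (hP i); apply: leq_trans (leq_maxr _ _); exact: leq_bigmax.
  by apply: Kle Ki; exact: leq_maxl.
(* A state is a point of [Q] with an open neighbourhood; the closure of the next neighbourhood lies
   in the old one and misses [K n]. *)
have QP (p : nat * (G * set G)) : exists q : G * set G,
    [/\ Q p.2.1, open p.2.2 & p.2.2 p.2.1] ->
    [/\ Q q.1, open q.2 & q.2 q.1] /\
    closure q.2 `<=` p.2.2 /\ closure q.2 `&` K p.1 = set0.
  case: p => n [x O] /=.
  have [[Qx oO Ox]|nx] := pselect [/\ Q x, open O & O x]; last first.
    by exists (x, O) => /nx.
  have [y [Qy Oy nKy]] := meager n x O Qx oO Ox.
  have [||W [oW Wy WO]] := @nbhs_closure_sub y (O `&` ~` K n).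
  - by apply: openI => //; exact: closed_openC.
  - by [].
  exists (y, W) => _; split=> //; split=> [z /WO[]//|].
  by apply/seteqP; split=> // z [/WO[]].
have [f fP] := choice QP; pose s n := iteri n (fun n p => f (n, p)) (1, setT).
have sP n : [/\ Q (s n).1, open (s n).2 & (s n).2 (s n).1].
  elim: n => [|n /(fP (n, s n))[]//].
  by split=> //; [exists 0%N => //; exact: subgroup1 | exact: openT].
have sS n := fP (n, s n) (sP n).
have clQ : closed Q by exact: compact_closed.
pose E n := closure (s n.+1).2 `&` Q.
have clE n : closed (E n) by apply: closedI => //; exact: closed_closure.
have [|n|n|z Ez] := nested_compact clE.
- by apply: (subclosed_compact (clE 0%N) cQ) => x [].
- by have [Qs _ ss] := sP n.+1; exists (s n.+1).1; split=> //;
    exact: subset_closure.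
- move=> x [clx Qx]; split=> //; apply: subset_closure.
  by have [_ [cl _]] := sS n.+1; exact: cl clx.
have [m _ Kz] : Q z by case: (Ez 0%N).
have [_ [_ /seteqP[e _]]] := sS m.
by apply: (e z); split=> //; case: (Ez m).
Qed.

End Baire.

(** * Tidy subgroups are minimizing, and conversely *)

Section Main.
Variables (G : topologicalGroupType) (alpha : UMagmaMorphism.type G G).
Hypothesis alpha_cont : continuous alpha.
Hypothesis hsG : hausdorff_space G.
Implicit Types (A B U V W : set G) (x y : G).
Local Notation plus := (plus_part alpha).
Local Notation minus := (minus_part alpha).
Local Notation image n := (iter_image alpha n).

(** [U] itself makes the class nonempty, so [scale] is an attained minimum and not the default
    [0]. *)
Lemma minimizingP U : compact_open_subgroup U -> minimizing alpha U <->
  forall W, compact_open_subgroup W ->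
    (displacement_index alpha U <= displacement_index alpha W)%N.
Proof.
move=> hU.
have [sc scmin] : is_min
    [set displacement_index alpha V | V in @compact_open_subgroup G]
    (scale alpha).
  have [W hW minW] := exists_minimal (displacement_index alpha)
    (ex_intro (@compact_open_subgroup G) _ hU).
  apply: xgetPex; exists (displacement_index alpha W); split; first by exists W.
  by move=> _ [V hV <-]; exact: minW.
split=> [[_ ->] W hW|minU]; first by apply: scmin; exists W.
split=> //; apply/eqP; rewrite eqn_leq; apply/andP; split;
  last by apply: scmin; exists U.
by case: sc => W hW <-; exact: minU.
Qed.

(** [(d_1 V)^n <= C * d_n V <= C * D * d_n W <= C * D * (d_1 W)^n] for all [n], and constants do not
    affect exponential growth. *)
Lemma multiplicative_minimal V C : compact_open_subgroup V ->
  (forall n, displacement_index alpha V ^ n <= C * displacement alpha n V)%N ->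
  forall W, compact_open_subgroup W ->
    (displacement_index alpha V <= displacement_index alpha W)%N.
Proof.
move=> hV VC W hW; have [D DP] := displacement_comparable alpha_cont hV hW.
apply: (@exp_le_mul_exp _ _ (C * D)) => n; apply: leq_trans (VC n) _.
rewrite -mulnA leq_mul2l; apply/orP; right; apply: leq_trans (DP n) _.
by rewrite leq_mul2l displacement_le_exp // orbT.
Qed.

Lemma plusplus_part_capE U N :
  (forall n, image n (plus U) `&` U `<=` image N (plus U)) ->
  plusplus_part alpha U `&` U = image N (plus U) `&` U.
Proof.
move=> H; apply/seteqP; split=> x [Ux Vx]; split=> //; last by exists N.
by case: Ux => n _ Ux; exact: (H n).
Qed.

Lemma tidy_minimal U : compact_open_subgroup U -> TA alpha U -> TB1 alpha U ->
  TB2 alpha U -> forall W, compact_open_subgroup W ->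
    (displacement_index alpha U <= displacement_index alpha W)%N.
Proof.
move=> hU ta tb1 [c cP]; have [sU cU oU] := hU.
have sP := subgroup_plus_part alpha sU; have sM := subgroup_minus_part alpha sU.
have PaP := @plus_part_sub_image _ alpha U.
have finP := finite_index_plus_part alpha_cont hU.
have clU := open_subgroup_closed sU oU.
have stepE n : step_index alpha (plus U) n = step_index alpha (plus U) 0.
  by rewrite /step_index !cP.
have sI n : subgroup (image n (plus U)) by exact: subgroup_iter_image.
have clI n : closed (image n (plus U)).
  by apply: compact_closed => //; apply: iter_image_compact => //;
    exact: plus_part_compact.
(* (TB1) makes the union [U_{++} /\ U] of this chain compact. *)
have [||||N NP] :=
  @ascending_subgroups_stationary G hsG (fun n => image n (plus U) `&` U).
- by move=> n; exact: subgroupI.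
- by move=> n; exact: closedI.
- by move=> n x [/image_plus_partS].
- by rewrite -setI_bigcupl setIC; exact: compact_closedI.
(* By (TB2) [step_index_inj] applies at every level; it lowers the level of [x] one by one down to
   [n]. *)
have back1 n x : plusplus_part alpha U x ->
    image n.+1 (plus U) (alpha x) -> image n (plus U) x.
  move=> [m _ Ux] Uax.
  have [mn|nm] := leqP m n; first exact: (image_plus_part_le mn).
  rewrite -(subnK nm) in Ux; elim: (m - n.+1)%N Ux => [|j IH] Ux.
    by apply: (step_index_inj sP PaP finP) => //; rewrite !stepE.
  apply: IH; apply: (step_index_inj sP PaP finP) => //; first by rewrite !stepE.
  by apply: image_plus_part_le Uax; lia.
have aPP x : plusplus_part alpha U x -> plusplus_part alpha U (alpha x).
  by move=> [n _ Nx]; exists n.+1 => //; rewrite iter_imageS; exists x.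
have back i n x : plusplus_part alpha U x ->
    image (n + i) (plus U) (iter i alpha x) -> image n (plus U) x.
  elim: i n x => [|i IH] n x Ux; first by rewrite addn0.
  rewrite iterSr addnS -addSn => Uix; apply: back1 => //.
  by apply: IH => //; exact: aPP.
apply: (@multiplicative_minimal U 1) => // n; rewrite mul1n.
rewrite (displacement_exp alpha_cont hU sP) //.
- exact: plus_part_sub.
- exact: TA_factor.
(* The factor [q] lies in [U_{++}] and in [U_-], so [alpha^N q] is in [alpha^N U_+] by the choice of
   [N]; pulling back [N] times puts [q] in [U_+]. *)
move=> {}n x [Ux Vx]; have [p [q [Pp Mq xE]]] := TA_factor ta Vx.
have Uq : plusplus_part alpha U q.
  rewrite (_ : q = p^-1 * x); last by rewrite xE mulKg.
  apply: subgroupVM; [exact: subgroup_plusplus_part | | by exists n].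
  by exists 0%N => //; exists p.
have P0 : image 0 (plus U) = plus U by exact: image_id.
rewrite xE; apply: subgroupM => //; rewrite -P0; apply: (back N) => //.
have [k _ UNq] : plusplus_part alpha U (iter N alpha q).
  by elim: N {NP} => // N IH; exact: aPP.
by have [] // : (image N (plus U) `&` U) (iter N alpha q); apply: (NP k);
  split=> //; case: Mq.
Qed.

Lemma minimal_TB U : compact_open_subgroup U -> TA alpha U ->
  (forall W, compact_open_subgroup W ->
    (displacement_index alpha U <= displacement_index alpha W)%N) ->
  TB1 alpha U /\ TB2 alpha U.
Proof.
move=> hU ta minU; have [sU cU oU] := hU.
have sP := subgroup_plus_part alpha sU.
have PaP := @plus_part_sub_image _ alpha U.
have finP := finite_index_plus_part alpha_cont hU.
pose d := displacement_index alpha U; pose c := step_index alpha (plus U).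
pose K n := image n (plus U) `&` U.
have sI n : subgroup (image n (plus U)) by exact: subgroup_iter_image.
have sK n : subgroup (K n) by exact: subgroupI.
have K0 : K 0%N = plus U.
  rewrite /K [image 0 _]image_id; apply/seteqP; split=> x; first by case.
  by move=> Ux; split=> //; exact: plus_part_sub Ux.
have Kle m n : (m <= n)%N -> K m `<=` K n.
  by move=> mn x [/(image_plus_part_le mn)].
have fact n := displacement_factor alpha_cont n hU sP
  (@plus_part_sub _ alpha U) (TA_factor ta).
have c0 : c 0%N = d.
  rewrite /d -displacement1; have [_ ->] := fact 1%N.
  by rewrite (image_plus_part_cap alpha U) /c /step_index [image 0 _]image_id.
have d0 : (0 < d)%N by exact: (displacement_gt0 alpha_cont 1 hU).
(* For a multiplicative [V], [d ^ n <= (d_1 V)^n = d_n V <= C * d_n U]. *)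
have [C dC] : exists C, forall n, (d ^ n <= C * displacement alpha n U)%N.
  have [V [hV VE]] := exists_multiplicative alpha_cont hsG hU.
  have [C CP] := displacement_comparable alpha_cont hV hU; exists C => n.
  by apply: leq_trans (CP n); rewrite VE; case: n => // n;
    rewrite leq_exp2r // minU.
have fKP n : finite_index (K n) (plus U).
  have [fn _] := chain_index sP PaP finP n.
  have [] // := @index_sub _ (K n) (plus U) (image n (plus U)) (plus U) => //.
    by move=> x [].
  by move=> x y; exact: subgroupVM.
pose m n := subgroup_index (K n) (plus U).
have am n : (displacement alpha n U * m n = \prod_(k < n) c k)%N.
  have [fn ->] := fact n; have [_ <-] := chain_index sP PaP finP n.
  have KP : plus U `<=` K n by rewrite -K0; exact: Kle.
  by have [] := index_mul (sI n) (sK n) sP KP (@subIsetl _ _ _) fn (fKP n).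
have m0 n : (0 < m n)%N by exact: index_gt0.
have cle := @step_index_le _ alpha (plus U) sP finP.
(* The step indices decrease weakly from [d]: the first [k] are at most [d], the others at most
   [c k]. *)
have prod_le k n : (\prod_(i < k + n) c i <= d ^ k * c k ^ n)%N.
  elim: n => [|n IH].
    rewrite addn0 muln1; elim: k => [|k IH]; first by rewrite big_ord0.
    by rewrite big_ord_recr /= expnSr leq_mul // -c0 cle.
  by rewrite addnS big_ord_recr /= expnSr mulnA leq_mul // cle // leq_addr.
(* Cancelling [d ^ k] in [d ^ (k + n) <= C * (d ^ k * c k ^ n)] and letting [n] grow gives
   [d <= c k]. *)
have cE k : c k = d.
  apply/eqP; rewrite eqn_leq -{1}c0 cle //=.
  apply: (@exp_le_mul_exp _ _ C) => n;
    rewrite -(@leq_pmul2l (d ^ k)) ?expn_gt0 ?d0 //.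
  rewrite -expnD; apply: leq_trans (dC _) _.
  rewrite mulnCA leq_mul2l; apply/orP; right.
  by apply: leq_trans (prod_le k n); rewrite -am leq_pmulr.
have mC n : (m n <= C)%N.
  rewrite -(@leq_pmul2l (d ^ n)) ?expn_gt0 ?d0 //.
  apply: leq_trans (leq_mul (dC n) (leqnn _)) _;
    rewrite -mulnA am mulnC leq_mul2r.
  by have := prod_le 0%N n; rewrite add0n mul1n c0 => ->; rewrite orbT.
split; last by exists d.
(* [N] maximizes the bounded index [m]; for [n] beyond [N], multiplicativity then gives [[K n : K N]
   = 1]. *)
have [N Nmax] : exists N, forall n, (m n <= m N)%N.
  have exm : exists k, `[< exists n, m n = k >].
    by exists (m 0%N); apply/asboolP; exists 0%N.
  have ubm k : `[< exists n, m n = k >] -> (k <= C)%N by move=> /asboolP[n <-].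
  case: (ex_maxnP exm ubm) => k /asboolP[N <-] maxm; exists N => n.
  by apply: maxm; apply/asboolP; exists n.
have KN n : K n `<=` K N.
  have [/Kle//|Nn] := leqP n N; have KNn := Kle _ _ (ltnW Nn).
  have KP : plus U `<=` K N by rewrite -K0; exact: Kle.
  have [||fn _] := index_sub (sK N) sP (fKP n) (@subset_refl _ (K n)).
  - by move=> x [_ /KP].
  - by move=> x y; exact: subgroupVM.
  have [_ E] := index_mul (sK n) (sK N) sP KP KNn fn (fKP N).
  apply: (index_le1 (sK n) (sK N) fn).
  by rewrite -(leq_pmul2r (m0 N)) mul1n -E; exact: Nmax.
have KE : plusplus_part alpha U `&` U = K N.
  by apply: plusplus_part_capE => n x /(KN n)[].
have clK : closed (K N).
  apply: closedI; last exact: open_subgroup_closed.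
  by apply: compact_closed => //; apply: iter_image_compact => //;
    exact: plus_part_compact.
have sPP := subgroup_plusplus_part alpha sU.
(* A subgroup with closed trace on the open subgroup [U] is closed: an element [h] of [U_{++}] close
   to the limit point [x] brings it into [U]. *)
move=> x clx; have [|h [Uh /= Uxh]] := clx [set h | U (x^-1 * h)].
  by apply: nbhs_translate => //; rewrite mulVg; exact: subgroup1.
have Uhx : U (h^-1 * x) by have := subgroupV sU Uxh; rewrite invgM invgK.
rewrite -[x](mulVKg h); apply: subgroupM => //.
have [] // : (plusplus_part alpha U `&` U) (h^-1 * x).
rewrite KE; apply: clK => B nB; rewrite -KE.
have [|z [Uz /= [Bz Uhz]]] := clx [set z | (B `&` U) (h^-1 * z)].
  apply: mulg_continuousl; apply: filterI => //.
  exact: open_nbhs_nbhs.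
by exists (h^-1 * z); split=> //; split=> //; exact: subgroupVM.
Qed.

End Main.

Theorem theorem7p7 (G : topologicalGroupType)
  (lcG : locally_compact [set: G]) (tdG : totally_disconnected [set: G])
  (alpha : UMagmaMorphism.type G G) (alpha_cont : continuous alpha)
  (U : set G) (hU : compact_open_subgroup U) :
  minimizing alpha U <-> [/\ TA alpha U, TB1 alpha U & TB2 alpha U].
Proof.
have hsG := totally_disconnected_hausdorff tdG.
apply: (iff_trans (minimizingP alpha hU)); split=> [minU|[ta tb1 tb2]];
  last first.
  exact: tidy_minimal.
have ta : TA alpha U.
  apply: (minimal_TA alpha_cont hsG (C := @compact_open_subgroup G)) => // W.
  exact: compact_open_forward.
by have [] := minimal_TB alpha_cont hsG hU ta minU.
Qed.
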